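(* Let $G$ be a graph with $n$ vertices $v_1,\ldots,v_n$, $m\ge 1$ edges and degree sequence $d_1,\ldots,d_n$, with Laplacian eigenvalues $\mu_1\ge\mu_2\ge\cdots\ge\mu_{n-1}\ge\mu_n=0$. Let $\phi$ be a real number with $\mu_{n-1}\le\phi\le\mu_1$. Then $$\left(\frac{n(\Upsilon+\phi^4)-(Z_g(G)+2m+\phi^2)^2}{n(Z_g(G)+2m+\phi^2)}\right)^{\frac12}\ \le\ S_L(G).$$
   Context: Graphs are finite, simple and undirected; $d_i$ is the degree of $v_i$ and $v_s\sim v_i$ means adjacency. The Laplacian matrix is $L(G)=D(G)-A(G)$, and the Laplacian spread is $S_L(G)=\mu_1-\mu_{n-1}$. The first Zagreb index is $Z_g(G)=\sum_{i=1}^n d_i^2$. For $i\ne j$, $\varkappa_{ij}=\varkappa_{ji}$ is the number of common neighbors of $v_i$ and $v_j$. The quantity $\Upsilon$ is $$\Upsilon=\sum_{i=1}^n(d_i^4+3d_i^3)+Z_g(G)+\sum_{i=1}^n\left(\sum_{s=1,\,s\ne i}^n\varkappa_{is}^2+\sum_{v_s\sim v_i}\Big(2d_i(d_s-\varkappa_{si})+d_s(d_s-2\varkappa_{si})\Big)\right).$$ *)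

(* Defs.v *)
From HB Require Import structures.
From mathcomp Require Import all_boot all_order all_algebra.
From mathcomp Require Import reals.

Set Implicit Arguments.
Unset Strict Implicit.
Unset Printing Implicit Defensive.

Import Order.TTheory GRing.Theory Num.Theory.
Local Open Scope ring_scope.

Record graph (n : nat) := Graph {
  adj : rel 'I_n;
  adj_sym : symmetric adj;
  adj_irr : irreflexive adj
}.

Section Combinatorics.
Variables (n : nat) (G : graph n).
Implicit Types i j : 'I_n.

Definition edges : {set {set 'I_n}} :=
  [set [set p.1; p.2] | p : 'I_n * 'I_n & adj G p.1 p.2].

Definition deg i : nat := #|[set j | adj G i j]|.

Definition common_nbrs i j : nat := #|[set k | adj G i k && adj G j k]|.

End Combinatorics.

Section Laplacian.
Variables (R : realType) (n : nat) (G : graph n).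

Definition adjacency_mx : 'M[R]_n := \matrix_(i, j) (adj G i j)%:R.

Definition degree_mx : 'M[R]_n := diag_mx (\row_i (deg G i)%:R).

Definition laplacian_mx : 'M[R]_n := degree_mx - adjacency_mx.

(* [mu] lists all the eigenvalues, with algebraic multiplicity, in
   nonincreasing order; these two conditions determine [mu]. *)
Definition laplacian_eigenvalues (mu : n.-tuple R) : Prop :=
  char_poly laplacian_mx = \prod_(x <- mu) ('X - x%:P) /\ sorted >=%R mu.

(* Everything is cast to [R] before subtracting, since [d s - 2 * k s i] can
   be negative. *)
Let d (i : 'I_n) : R := (deg G i)%:R.
Let k (i j : 'I_n) : R := (common_nbrs G i j)%:R.

Definition zagreb1 : R := \sum_i d i ^+ 2.

Definition Upsilon : R :=
  \sum_i (d i ^+ 4 + 3 * d i ^+ 3) + zagreb1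
  + \sum_i (\sum_(s | s != i) k i s ^+ 2
            + \sum_(s | adj G s i) (2 * d i * (d s - k s i)
                                    + d s * (d s - 2 * k s i))).

End Laplacian.

(* Eigenvalues are numbered from 1, while tuples are indexed from 0. *)
Definition eigval (R : realType) (n : nat) (mu : n.-tuple R) (i : nat) : R :=
  mu`_i.-1.

(* The difference between the first and the last-but-one eigenvalue; it is
   meant for [2 <= n]. *)
Definition laplacian_spread (R : realType) (n : nat) (mu : n.-tuple R) : R :=
  eigval mu 1 - eigval mu n.-1.

(* Main.v *)
Require Import Defs.
From HB Require Import structures.
From mathcomp Require Import all_boot all_order all_algebra.
From mathcomp Require Import reals.
From mathcomp Require Import ring.

Import Order.TTheory GRing.Theory Num.Theory.
Local Open Scope ring_scope.

(** Put [a = mu_(n-1)], [b = mu_1], and replace the last eigenvalue, which is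
    [0], by [phi].  The Laplacian is positive semidefinite, so this gives [n]
    numbers [x] with [0 <= a <= x <= b], and the two sums that occur in the
    bound are their power sums:

      [S2 = \sum x^2 = \tr (L^2) + phi^2 = Z_g + 2 m + phi^2],
      [S4 = \sum x^4 = \tr (L^4) + phi^4 = Upsilon + phi^4].

    Since [(b^2 - x^2) (x^2 - a^2) >= 0] for each [x], summing gives
    [S4 <= (a^2 + b^2) S2 - n (a b)^2].  Multiplying by [n] and using
    [(S2 - n a b)^2 >= 0] yields [n S4 - S2^2 <= n S2 (b - a)^2]
    ([sum_pow4_le]), which is the claim.

    The trace identities have an arithmetic half and a combinatorial half.
    First, if the characteristic polynomial of [A] splits with roots [s], that
    of [A^2] splits with roots the squares of [s] ([char_poly_sqr_roots]);
    this is read off from [det (X^2 - A^2) = det (X - A) det (X + A)].  Applied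
    once and twice to [L], it expresses [\tr (L^2)] and [\tr (L^4)] through
    [mu].
    Second, the entries of [L^2] are known explicitly ([laplacian_sqrE]), and
    [\tr (L^4)] is the sum of their squares because [L^2] is symmetric
    ([Upsilon_trace]). *)

(** * Power sums of eigenvalues as traces *)

Lemma size_char_poly_roots {R : idomainType} {n : nat} {A : 'M[R]_n}
    {s : seq R} :
  char_poly A = \prod_(x <- s) ('X - x%:P) -> size s = n.
Proof.
by move=> hA; have := size_char_poly A; rewrite hA size_prod_XsubC => -[].
Qed.

Lemma mxtrace_char_poly_roots {R : idomainType} {n : nat} {A : 'M[R]_n}
    {s : seq R} :
  char_poly A = \prod_(x <- s) ('X - x%:P) -> \tr A = \sum_(x <- s) x.
Proof.
move=> hA.
have hs := size_char_poly_roots hA.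
case: n A hA hs => [|n] A hA hs.
  by rewrite /mxtrace big_ord0 (size0nil hs) big_nil.
by apply: oppr_inj; rewrite -char_poly_trace // hA -hs coefPn_prod_XsubC ?hs //.
Qed.

Lemma char_poly_comp_opp (R : comNzRingType) (n : nat) (A : 'M[R]_n) :
  char_poly A \Po (- 'X) = (-1) ^+ n * \det ('X%:M + map_mx polyC A).
Proof.
rewrite -detZ /char_poly.
rewrite -[LHS](det_map_mx (comp_poly (- 'X))); congr (\det _).
apply/matrixP=> i j; rewrite !mxE rmorphB /= rmorphMn /= comp_polyX comp_polyC.
by rewrite mulN1r opprD mulNrn.
Qed.

(** This is [det (X^2 - A^2) = det (X - A) det (X + A)]; the sign comes from
    writing the second factor as a value of [char_poly A] at [-X]. *)
Lemma char_poly_sqr_comp (R : comNzRingType) (n : nat) (A : 'M[R]_n) :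
  char_poly (A *m A) \Po 'X^2
  = (-1) ^+ n * (char_poly A * (char_poly A \Po (- 'X))).
Proof.
rewrite char_poly_comp_opp [char_poly A * _]mulrCA signrMK.
rewrite {2}/char_poly -det_mulmx /char_poly.
rewrite -[LHS](det_map_mx (comp_poly 'X^2)); congr (\det _).
rewrite /char_poly_mx mulmxBl !mulmxDr -scalar_mxM scalar_mxC -map_mxM.
rewrite opprD addrA addrK.
apply/matrixP=> i j; rewrite !mxE rmorphB /= rmorphMn /= comp_polyX comp_polyC.
by rewrite -expr2.
Qed.

(** The product of the [(X - x) (X + x)] is the product of the [X^2 - x^2],
    and a polynomial is determined by its composite with ['X^2]. *)
Lemma char_poly_sqr_roots {R : idomainType} {n : nat} {A : 'M[R]_n}
    {s : seq R} :
  char_poly A = \prod_(x <- s) ('X - x%:P) ->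
  char_poly (A *m A) = \prod_(x <- [seq x ^+ 2 | x <- s]) ('X - x%:P).
Proof.
move=> hA.
have hs := size_char_poly_roots hA.
have inj : injective (comp_poly ('X^2 : {poly R})).
  move=> p q /polyP hpq; apply/polyP => i.
  by have := hpq (i * 2)%N; rewrite !coef_comp_poly_Xn // dvdn_mull ?mulnK.
(* Each root contributes one factor -1, and these cancel [(-1) ^+ n]. *)
apply: inj; rewrite char_poly_sqr_comp hA big_map !rmorph_prod /=.
rewrite -big_split /= -hs; elim: {hA hs} s => [|x s IH].
  by rewrite !big_nil mulr1.
rewrite !big_cons -IH /= exprS !comp_polyB !comp_polyX !comp_polyC.
by rewrite rmorphXn /=; ring.
Qed.

(** * The inequality between power sums *)

(** Write [S2], [S4] for the two sums and [N] for the number of terms.  The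
    difference of the two sides is
    [N * \sum_x (b^2 - x^2) (x^2 - a^2) + (S2 - N a b)^2], and [0 <= a] makes
    the summands nonnegative. *)
Lemma sum_pow4_le {R : realDomainType} {s : seq R} {a b : R} :
  0 <= a -> (forall x, x \in s -> a <= x <= b) ->
  (size s)%:R * (\sum_(x <- s) x ^+ 4) - (\sum_(x <- s) x ^+ 2) ^+ 2
  <= (size s)%:R * (\sum_(x <- s) x ^+ 2) * (b - a) ^+ 2.
Proof.
move=> a0 hs.
set S2 := \sum_(x <- s) x ^+ 2; set S4 := \sum_(x <- s) x ^+ 4.
set N : R := (size s)%:R.
have pos : 0 <= (a ^+ 2 + b ^+ 2) * S2 - S4 - N * (a * b) ^+ 2.
  have -> : (a ^+ 2 + b ^+ 2) * S2 - S4 - N * (a * b) ^+ 2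
      = \sum_(x <- s) (b ^+ 2 - x ^+ 2) * (x ^+ 2 - a ^+ 2).
    rewrite /S2 /S4 /N {hs S2 S4 N}.
    elim: s => [|x s IH]; first by rewrite !big_nil /=; ring.
    by rewrite !big_cons -IH /= -natr1; ring.
  rewrite big_seq; apply: sumr_ge0 => x /hs /andP[ax xb].
  have x0 := le_trans a0 ax; have b0 := le_trans x0 xb.
  by rewrite mulr_ge0 // subr_ge0 ler_sqr.
have N0 : 0 <= N by apply: ler0n.
rewrite -subr_ge0.
have -> : N * S2 * (b - a) ^+ 2 - (N * S4 - S2 ^+ 2)
  = N * ((a ^+ 2 + b ^+ 2) * S2 - S4 - N * (a * b) ^+ 2)
    + (S2 - N * (a * b)) ^+ 2.
  by ring.
by rewrite addr_ge0 ?sqr_ge0 ?mulr_ge0.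
Qed.

(** * Entries of the squared Laplacian and their traces *)

Section Laplacian.
Variables (R : realType) (n : nat) (G : graph n).
Local Notation d i := ((deg G i)%:R : R).
Local Notation k i j := ((common_nbrs G i j)%:R : R).
Local Notation a i j := ((adj G i j)%:R : R).
Local Notation L := (laplacian_mx R G).

Lemma sum_adj i : \sum_j a i j = d i.
Proof.
rewrite /deg -sum1dep_card natr_sum [RHS]big_mkcond /=.
by apply: eq_bigr => j _; case: adj.
Qed.

Lemma common_nbrsC i j : common_nbrs G i j = common_nbrs G j i.
Proof. by apply: eq_card => u; rewrite !inE andbC. Qed.

Lemma sum_adj2 i j : \sum_u a i u * a u j = k i j.
Proof.
rewrite /common_nbrs -sum1dep_card natr_sum [RHS]big_mkcond /=.
by apply: eq_bigr => u _; rewrite (adj_sym G u j) -natrM mulnb; case: andb.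
Qed.

Lemma common_nbrs_diag i : common_nbrs G i i = deg G i.
Proof. by apply: eq_card => u; rewrite !inE andbb. Qed.

Lemma laplacian_mxE i j : L i j = d i *+ (i == j) - a i j.
Proof. by rewrite !mxE. Qed.

Lemma laplacian_sqrE i j :
  (L *m L) i j = (d i ^+ 2) *+ (i == j) - (d i + d j) * a i j + k i j.
Proof.
rewrite /laplacian_mx /degree_mx mulmxBl !mulmxBr.
rewrite !mul_mx_diag !mul_diag_mx !mxE.
under [in X in _ - (_ - X)]eq_bigr => u _ do rewrite !mxE.
by rewrite sum_adj2; case: eqP => [->|_]; rewrite /= ?(mulr1n, mulr0n); ring.
Qed.

(** An edge is the unordered pair of exactly two arcs, [(x, y)] and [(y, x)],
    which differ because there are no loops. *)
Lemma card_arcs : (#|[set p : 'I_n * 'I_n | adj G p.1 p.2]| = 2 * #|edges G|)%N.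
Proof.
rewrite -sum1_card (partition_big_imset (fun p => [set p.1; p.2])) /=.
have -> : [set [set p.1; p.2] | p in [set p : 'I_n * 'I_n | adj G p.1 p.2]]
   = edges G.
  by apply/setP=> e; apply/imsetP/imsetP=> -[p hp ->]; exists p => //;
    rewrite !inE in hp *.
rewrite mulnC -sum_nat_const; apply: eq_bigr => e /imsetP[[x y]].
rewrite inE /= => xy ->; have xNy : x != y by apply: contraTneq xy => ->; rewrite adj_irr.
rewrite sum1dep_card -(_ : #|[set (x, y); (y, x)]| = 2)%N; last first.
  by rewrite cards2 xpair_eqE negb_and xNy.
apply: eq_card => -[u w]; rewrite !inE /= !xpair_eqE.
apply/andP/orP => [[uw /eqP euw]|[]/andP[/eqP-> /eqP->]]; last first.
- by rewrite (adj_sym G) setUC.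
- by [].
have uNw : u != w by apply: contraTneq uw => ->; rewrite adj_irr.
have := set22 u w; have := set21 u w; rewrite euw !inE.
by move: uNw => /[swap]/orP[]/eqP-> /[swap]/orP[]/eqP->; rewrite ?eqxx //; auto.
Qed.

Lemma sum_deg : \sum_i d i = 2 * #|edges G|%:R.
Proof.
have arcs : (\sum_i deg G i = #|[set p : 'I_n * 'I_n | adj G p.1 p.2]|)%N.
  rewrite -sum1dep_card.
  rewrite -[RHS](pair_big_dep xpredT (fun i j => adj G i j)
                              (fun _ _ => 1%N)) /=.
  by apply: eq_bigr => i _; rewrite sum1dep_card.
by rewrite -natr_sum arcs card_arcs natrM.
Qed.

Lemma zagreb_trace : \tr (L *m L) = zagreb1 R G + \sum_i d i.
Proof.
rewrite /zagreb1 -big_split; apply: eq_bigr => i _ /=.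
by rewrite laplacian_sqrE eqxx (adj_irr G) common_nbrs_diag mulr0 subr0.
Qed.

(** The diagonal entries of [L^2] are [d_i^2 + d_i] and the others are
    [k_is - a_is (d_i + d_s)]; as [a_is] is 0 or 1, squaring the latter gives
    [k_is^2] plus, over the neighbours [s] of [i], the term
    [(d_i + d_s)^2 - 2 k_is (d_i + d_s)].  Its part [d_i^2] sums to [d_i^3],
    which turns the [2 d_i^3] of the diagonal into [3 d_i^3]. *)
Lemma Upsilon_trace : \tr ((L *m L) *m (L *m L)) = Upsilon R G.
Proof.
have sq i s : (L *m L) i s * (L *m L) s i =
   (d i ^+ 2 + d i) ^+ 2 *+ (s == i) + (if s != i then k i s ^+ 2 else 0)
   + a i s * (d i ^+ 2 + (2 * d i * (d s - k s i) + d s * (d s - 2 * k s i))).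
  rewrite !laplacian_sqrE (common_nbrsC s i) (eq_sym i s) (adj_sym G s i).
  case: (eqVneq s i) => [->|_] /=.
    by rewrite (adj_irr G) common_nbrs_diag !mulr1n /=; ring.
  by rewrite !mulr0n; case: adj => /=; ring.
rewrite /mxtrace /Upsilon /zagreb1 -!big_split; apply: eq_bigr => i _ /=.
rewrite mxE (eq_bigr _ (fun s _ => sq i s)) !big_split /=.
have -> : \sum_j (d i ^+ 2 + d i) ^+ 2 *+ (j == i) = (d i ^+ 2 + d i) ^+ 2.
  rewrite (bigD1 i) //= eqxx mulr1n big1 ?addr0 // => j /negPf ->.
  exact: mulr0n.
rewrite -big_mkcond /=.
under [X in _ + X = _]eq_bigr => s _ do rewrite mulrDr.
rewrite big_split /= -mulr_suml sum_adj.
have -> : \sum_s a i s * (2 * d i * (d s - k s i) + d s * (d s - 2 * k s i))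
  = \sum_(s | adj G s i) (2 * d i * (d s - k s i) + d s * (d s - 2 * k s i)).
  rewrite [RHS]big_mkcond; apply: eq_bigr => s _.
  by rewrite (adj_sym G i s); case: adj; rewrite ?mul1r ?mul0r.
by rewrite big_split /=; ring.
Qed.

(** * Signs of the Laplacian eigenvalues *)

Lemma laplacian_quadratic_form (v : 'I_n -> R) :
  2 * (\sum_i \sum_j v i * L i j * v j)
  = \sum_i \sum_j a i j * (v i - v j) ^+ 2.
Proof.
have diag : \sum_i \sum_j v i * L i j * v j =
   \sum_i d i * v i ^+ 2 - \sum_i \sum_j a i j * (v i * v j).
  rewrite -sumrB; apply: eq_bigr => i _.
  under eq_bigr => j _ do rewrite laplacian_mxE mulrBr mulrBl.
  rewrite sumrB (bigD1 i) //= eqxx mulr1n big1 => [|j]; last first.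
    by rewrite eq_sym => /negPf ->; rewrite mulr0n mulr0 mul0r.
  congr (_ - _); first by ring.
  by apply: eq_bigr => j _; ring.
have row : \sum_i \sum_j a i j * v i ^+ 2 = \sum_i d i * v i ^+ 2.
  by apply: eq_bigr => i _; rewrite -mulr_suml sum_adj.
have col : \sum_i \sum_j a i j * v j ^+ 2 = \sum_i d i * v i ^+ 2.
  rewrite exchange_big -row; apply: eq_bigr => i _; apply: eq_bigr => j _.
  by rewrite (adj_sym G).
have -> : \sum_i \sum_j a i j * (v i - v j) ^+ 2 =
   \sum_i \sum_j a i j * v i ^+ 2 + \sum_i \sum_j a i j * v j ^+ 2
   - 2 * (\sum_i \sum_j a i j * (v i * v j)).
  rewrite mulr_sumr -big_split -sumrB; apply: eq_bigr => i _ /=.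
  rewrite mulr_sumr -big_split -sumrB; apply: eq_bigr => j _ /=.
  by ring.
by rewrite diag row col; ring.
Qed.

(** For an eigenvector [v], the quadratic form of [L] at [v] is both
    [x * |v|^2] and a sum of nonnegative terms. *)
Lemma laplacian_eigenvalue_ge0 x : eigenvalue L x -> 0 <= x.
Proof.
case/eigenvalueP=> v hv v0.
have norm_gt0 : 0 < \sum_j v 0 j ^+ 2.
  rewrite lt0r sumr_ge0 ?andbT => [|j _]; last exact: sqr_ge0.
  apply: contra v0 => /eqP/psumr_eq0P v0; apply/eqP/rowP=> j; rewrite mxE.
  by apply/eqP; rewrite -sqrf_eq0 v0 // => *; apply: sqr_ge0.
rewrite -(pmulr_lge0 _ norm_gt0).
have -> : x * (\sum_j v 0 j ^+ 2) = \sum_i \sum_j v 0 i * L i j * v 0 j.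
  rewrite exchange_big mulr_sumr; apply: eq_bigr => j _ /=.
  by rewrite -mulr_suml; move/rowP: hv => /(_ j); rewrite !mxE => ->; ring.
rewrite -(pmulr_rge0 _ (@ltr0Sn R 1)) laplacian_quadratic_form.
by do 2![apply: sumr_ge0 => ? _]; rewrite mulr_ge0 ?ler0n ?sqr_ge0.
Qed.

(** Each column of [L] sums to 0, so the all-ones vector is an eigenvector. *)
Lemma laplacian_eigenvalue0 : (0 < n)%N -> eigenvalue L 0.
Proof.
move=> n0; apply/eigenvalueP; exists (const_mx 1).
  apply/rowP=> j; rewrite scale0r !mxE.
  transitivity (\sum_i (d i *+ (i == j) - a j i)).
    by apply: eq_bigr => i _; rewrite laplacian_mxE mxE mul1r (adj_sym G j i).
  rewrite sumrB sum_adj (bigD1 j) //= eqxx mulr1n big1 ?addr0 ?subrr //.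
  by move=> i /negPf ->.
apply/eqP=> /rowP /(_ (Ordinal n0)); rewrite !mxE; apply/eqP; exact: oner_neq0.
Qed.
End Laplacian.

Lemma sorted_ge_nth {R : realDomainType} {s : seq R} {i j : nat} :
  sorted >=%R s -> (i <= j)%N -> (j < size s)%N -> s`_j <= s`_i.
Proof.
move=> sorted_s ij j_lt.
have mono := sorted_leq_nth (@ge_trans _ R) (@ge_refl _ R) 0 sorted_s.
by apply: (mono i j) => //; rewrite inE (leq_ltn_trans ij).
Qed.

(** All eigenvalues are nonnegative and [0] is one of them, so the least one
    is [0]. *)
Lemma laplacian_eigenvalues_last {R : realType} {p : nat} {G : graph p.+2}
    {mu : p.+2.-tuple R} :
  laplacian_eigenvalues G mu -> mu`_p.+1 = 0.
Proof.
case=> char_mu sorted_mu.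
have mem_mu x : (x \in mu) = eigenvalue (laplacian_mx R G) x.
  by rewrite eigenvalue_root_char char_mu root_prod_XsubC.
have last_mu : mu`_p.+1 \in mu by rewrite mem_nth ?size_tuple.
apply/eqP; rewrite eq_le.
rewrite (laplacian_eigenvalue_ge0 R _ G) -?mem_mu // andbT.
have /(nthP 0)[i i_lt mu_i] : 0 \in mu by rewrite mem_mu laplacian_eigenvalue0.
rewrite size_tuple in i_lt.
have : mu`_p.+1 <= mu`_i by apply: sorted_ge_nth; rewrite ?size_tuple.
by rewrite mu_i.
Qed.

(** * The bound on the Laplacian spread *)

Theorem theorem25 (R : realType) (n m : nat) (G : graph n)
    (hm : #|edges G| = m) (m_ge1 : (1 <= m)%N)
    (mu : n.-tuple R) (hmu : laplacian_eigenvalues G mu)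
    (phi : R) (phi_ge : eigval mu n.-1 <= phi) (phi_le : phi <= eigval mu 1) :
  Num.sqrt
    ((n%:R * (Upsilon R G + phi ^+ 4)
        - (zagreb1 R G + 2 * m%:R + phi ^+ 2) ^+ 2)
     / (n%:R * (zagreb1 R G + 2 * m%:R + phi ^+ 2)))
  <= laplacian_spread mu.
Proof.
(* An edge has two distinct ends, so the indices 0 and [n - 2] are valid. *)
have n_gt1 : (1 < n)%N.
  move: m_ge1; rewrite -hm card_gt0 => /set0Pn[e /imsetP[[x y]]].
  rewrite inE /= => xy _; rewrite ltnNge; apply/negP => n_le1.
  have xy_eq : x = y.
    apply: val_inj; move: (leq_trans (ltn_ord y) n_le1).
    move: (leq_trans (ltn_ord x) n_le1); rewrite !ltnS !leqn0 /=.
    by move=> /eqP-> /eqP->.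
  by rewrite xy_eq adj_irr in xy.
case: n n_gt1 G hm mu hmu phi_ge phi_le => [|[|p]] // _ G hm mu hmu.
rewrite /laplacian_spread /eigval /= => phi_ge phi_le.
have [char_mu sorted_mu] := hmu.
have mu_anti i j : (i <= j)%N -> (j < p.+2)%N -> mu`_j <= mu`_i.
  by move=> ij jp; apply: sorted_ge_nth; rewrite ?size_tuple.
have mu_last := laplacian_eigenvalues_last hmu.
have tr2 : \sum_(x <- mu) x ^+ 2 = zagreb1 R G + 2 * m%:R.
  rewrite -hm -sum_deg -zagreb_trace.
  by rewrite (mxtrace_char_poly_roots (char_poly_sqr_roots char_mu)) big_map.
have tr4 : \sum_(x <- mu) x ^+ 4 = Upsilon R G.
  rewrite -Upsilon_trace.
  rewrite (mxtrace_char_poly_roots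
             (char_poly_sqr_roots (char_poly_sqr_roots char_mu))) !big_map.
  by apply: eq_bigr => x _; rewrite -exprM.
(* [s] lists [mu_1, ..., mu_(n-1)]; the last entry 0 of [mu] gives way to [phi]. *)
set s := take p.+1 mu.
have mu_rcons : mu = rcons s 0 :> seq R.
  by rewrite -mu_last -take_nth ?size_tuple // take_oversize ?size_tuple.
have sum_rcons_phi k : (0 < k)%N ->
    \sum_(x <- rcons s phi) x ^+ k = \sum_(x <- mu) x ^+ k + phi ^+ k.
  move=> k_gt0; rewrite mu_rcons -!cats1 !big_cat !big_seq1 /=.
  by rewrite expr0n eqn0Ngt k_gt0 addr0.
have size_s : size s = p.+1 by rewrite size_takel ?size_tuple.
have bounds x : x \in rcons s phi -> mu`_p <= x <= mu`_0.
  rewrite mem_rcons inE => /predU1P[->|/(nthP 0)[i]]; first exact/andP.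
  rewrite size_s => ip <-; rewrite nth_take //.
  by rewrite !mu_anti // ltnW.
have mup_ge0 : 0 <= mu`_p.
  by have := mu_anti p p.+1 (leqnSn p) (ltnSn p.+1); rewrite mu_last.
have := sum_pow4_le mup_ge0 bounds.
rewrite size_rcons size_s !sum_rcons_phi // tr2 tr4 => key.
have zagreb_ge0 : 0 <= zagreb1 R G by apply: sumr_ge0 => i _; apply: sqr_ge0.
have S2_gt0 : 0 < zagreb1 R G + 2 * m%:R + phi ^+ 2.
  by rewrite ltr_wpDr ?sqr_ge0 // ltr_wpDl // mulr_gt0 ?ltr0n.
have spread_ge0 : 0 <= mu`_0 - mu`_p by rewrite subr_ge0 mu_anti.
rewrite -[leRHS]ger0_norm // -sqrtr_sqr ler_wsqrtr //.
by rewrite ler_pdivrMr ?mulr_gt0 ?ltr0n // [leRHS]mulrC.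
Qed.
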